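(* Let $0<\mu_x\le L_x$, $0<\mu_y\le L_y$, $L_{xy}\ge0$, let $f\in\mathcal F(\mu_x,\mu_y,L_x,L_y,L_{xy})$, and run Alt-GDA on $f$ (from any initialization) with step sizes $\alpha,\beta>0$ that satisfy $$\alpha\le\frac12\min\left\{\frac1{L_x},\frac{\sqrt{\mu_y}}{L_{xy}\sqrt{L_x}}\right\},\qquad \beta\le\frac12\min\left\{\frac1{L_y},\frac{\sqrt{\mu_x}}{L_{xy}\sqrt{L_y}}\right\}.$$ Then $\Psi^{\mathrm{Alt}}_k$ is valid, i.e. there is a constant $A>0$ with $\Psi^{\mathrm{Alt}}_k\ge A\|z_k-z_\star\|^2$ for all $k$, and $\Psi^{\mathrm{Alt}}_{k+1}\le r\,\Psi^{\mathrm{Alt}}_k$ for all $k\ge0$ with $$r=\max\left\{\frac{\frac1\alpha-\mu_x}{\frac1\alpha-2\beta^2L_yL_{xy}^2},\ \frac{\frac1\beta-\mu_y}{\frac1\beta-\alpha^2L_xL_{xy}^2},\ \frac{\frac1\alpha-\mu_x}{\frac1\alpha}\right\},$$ where $0<r<1$.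
   Context: Function class. For $0<\mu_x\le L_x$, $0<\mu_y\le L_y$, $L_{xy}\ge0$, $\mathcal F(\mu_x,\mu_y,L_x,L_y,L_{xy})$ is the set of all twice-differentiable $f:\mathbb R^{d_x}\times\mathbb R^{d_y}\to\mathbb R$ (any $d_x,d_y$) such that: (i) $f(\cdot,y)$ is $\mu_x$-strongly convex for every $y$ and $f(x,\cdot)$ is $\mu_y$-strongly concave for every $x$ ($g$ is $\mu$-strongly convex if $g(z')\ge g(z)+\langle\nabla g(z),z'-z\rangle+\frac\mu2\|z'-z\|^2$ for all $z,z'$; $g$ is $\mu$-strongly concave if $-g$ is $\mu$-strongly convex); (ii) for all $x,x',y,y'$: $\|\nabla_xf(x',y)-\nabla_xf(x,y)\|\le L_x\|x'-x\|$, $\|\nabla_yf(x,y')-\nabla_yf(x,y)\|\le L_y\|y'-y\|$, $\|\nabla_xf(x,y')-\nabla_xf(x,y)\|\le L_{xy}\|y'-y\|$, $\|\nabla_yf(x',y)-\nabla_yf(x,y)\|\le L_{xy}\|x'-x\|$. Norms are Euclidean. Every such $f$ has a unique Nash equilibrium $z_\star=(x_\star,y_\star)$, i.e. a point with $f(x_\star,y)\le f(x_\star,y_\star)\le f(x,y_\star)$ for all $x,y$. Alt-GDA with constant step sizes $\alpha,\beta>0$: $x_{k+1}=x_k-\alpha\nabla_xf(x_k,y_k)$, $y_{k+1}=y_k+\beta\nabla_yf(x_{k+1},y_k)$; $z_k=(x_k,y_k)$. Lyapunov function: with $V^{\mathrm{Alt}}(x,y)=\left(\frac1\alpha-\mu_x\right)\|x-x_\star\|^2+\left(\frac1\beta-\mu_y\right)\|y-y_\star\|^2$,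 $$\Psi^{\mathrm{Alt}}_k=V^{\mathrm{Alt}}(x_k,y_k)+V^{\mathrm{Alt}}(x_{k+1},y_k)-\alpha(1-\alpha L_x)\|\nabla_xf(x_k,y_k)\|^2 .$$ Convention: if $L_{xy}=0$, a fraction with $L_{xy}$ in the denominator is $+\infty$. *)

(* Defs.v *)
From HB Require Import structures.
From mathcomp Require Import all_boot all_order all_algebra.
From mathcomp Require Import all_classical all_reals all_analysis.

Set Implicit Arguments.
Unset Strict Implicit.
Unset Printing Implicit Defensive.

Import Order.TTheory GRing.Theory Num.Theory.
Import numFieldNormedType.Exports.

Local Open Scope ring_scope.

Section Definitions.
Context {R : realType}.

(* The library norm `|u| on 'rV[R]_n is the sup norm, hence a separate
   Euclidean norm; differentiability does not depend on this choice. *)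
Definition dotv n (u v : 'rV[R]_n) : R := \sum_(i < n) u 0 i * v 0 i.

Definition enorm n (u : 'rV[R]_n) : R := Num.sqrt (dotv u u).

Definition enorm_pair m n (z : 'rV[R]_m * 'rV[R]_n) : R :=
  Num.sqrt (enorm z.1 ^+ 2 + enorm z.2 ^+ 2).

Definition grad n (g : 'rV[R]_n -> R) (x : 'rV[R]_n) : 'rV[R]_n :=
  \row_(i < n) 'D_(delta_mx 0 i) g x.

Definition strongly_convex n (mu : R) (g : 'rV[R]_n -> R) : Prop :=
  forall z z', g z' >= g z + dotv (grad g z) (z' - z)
                       + mu / 2 * enorm (z' - z) ^+ 2.

Definition strongly_concave n (mu : R) (g : 'rV[R]_n -> R) : Prop :=
  strongly_convex mu (fun z => - g z).

Section TwoBlocks.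
Variables dx dy : nat.
Implicit Types f : 'rV[R]_dx * 'rV[R]_dy -> R.

Definition gradx f (x : 'rV[R]_dx) (y : 'rV[R]_dy) : 'rV[R]_dx :=
  grad (fun u => f (u, y)) x.

Definition grady f (x : 'rV[R]_dx) (y : 'rV[R]_dy) : 'rV[R]_dy :=
  grad (fun v => f (x, v)) y.

(* Joint Frechet differentiability of f and of its full gradient, the latter
   representing the derivative of f. *)
Definition twice_differentiable f : Prop :=
  (forall z, differentiable f z) /\
  (forall z, differentiable
     (fun w : 'rV[R]_dx * 'rV[R]_dy => (gradx f w.1 w.2, grady f w.1 w.2)) z).

Record function_class (mu_x mu_y L_x L_y L_xy : R) f : Prop := FunctionClass {
  class_twice_diff : twice_differentiable f;
  class_convex_x : forall y, strongly_convex mu_x (fun x => f (x, y));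
  class_concave_y : forall x, strongly_concave mu_y (fun y => f (x, y));
  class_lip_xx : forall x x' y,
    enorm (gradx f x' y - gradx f x y) <= L_x * enorm (x' - x);
  class_lip_yy : forall x y y',
    enorm (grady f x y' - grady f x y) <= L_y * enorm (y' - y);
  class_lip_xy : forall x y y',
    enorm (gradx f x y' - gradx f x y) <= L_xy * enorm (y' - y);
  class_lip_yx : forall x x' y,
    enorm (grady f x' y - grady f x y) <= L_xy * enorm (x' - x)
}.

Definition nash_equilibrium f (z : 'rV[R]_dx * 'rV[R]_dy) : Prop :=
  forall x y, f (z.1, y) <= f z /\ f z <= f (x, z.2).

Definition alt_gda f (alpha beta : R)
    (x : nat -> 'rV[R]_dx) (y : nat -> 'rV[R]_dy) : Prop :=
  forall k, x k.+1 = x k - alpha *: gradx f (x k) (y k) /\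
            y k.+1 = y k + beta *: grady f (x k.+1) (y k).

Definition V_alt (mu_x mu_y alpha beta : R) (zs : 'rV[R]_dx * 'rV[R]_dy)
    (x : 'rV[R]_dx) (y : 'rV[R]_dy) : R :=
  (1 / alpha - mu_x) * enorm (x - zs.1) ^+ 2
  + (1 / beta - mu_y) * enorm (y - zs.2) ^+ 2.

Definition Psi_alt f (mu_x mu_y L_x alpha beta : R)
    (zs : 'rV[R]_dx * 'rV[R]_dy)
    (x : nat -> 'rV[R]_dx) (y : nat -> 'rV[R]_dy) (k : nat) : R :=
  V_alt mu_x mu_y alpha beta zs (x k) (y k)
  + V_alt mu_x mu_y alpha beta zs (x k.+1) (y k)
  - alpha * (1 - alpha * L_x) * enorm (gradx f (x k) (y k)) ^+ 2.

End TwoBlocks.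

(* Stated in \bar R, where 0^-1 = +oo: when L_xy = 0 the second fraction is
   +oo, since its numerator is positive. *)
Definition step_size_cond (mu L L_xy alpha : R) : Prop :=
  (alpha%:E <= (1 / 2)%:E *
     Order.min (1%:E / L%:E)
               ((Num.sqrt mu)%:E / (L_xy * Num.sqrt L)%:E))%E.

Definition rate_alt (mu_x mu_y L_x L_y L_xy alpha beta : R) : R :=
  Num.max
    (Num.max
       ((1 / alpha - mu_x) / (1 / alpha - 2 * beta ^+ 2 * L_y * L_xy ^+ 2))
       ((1 / beta - mu_y) / (1 / beta - alpha ^+ 2 * L_x * L_xy ^+ 2)))
    ((1 / alpha - mu_x) / (1 / alpha)).

End Definitions.

(* Main.v *)
(* Write (xs, ys) for the equilibrium and x', y' for the iterates after x_k,
   y_k. Strong convexity in x and strong concavity in y turn each half-step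
   into a bound on the new squared distance by the old one, a difference of
   values of f and a squared gradient. Add the bound for the x-step at times k
   and k+1 and twice the bound for the y-step at time k: after the descent
   lemma is used at (x_k, y_k) in x and at (x', y_k) in y, the values of f
   which remain are 2 (f(xs, y_k) + f(xs, y') - 2 f(x', ys)), and the last term
   -alpha (1 - alpha L_x) |grad_x f(x_k, y_k)|^2 of Psi is exactly absorbed.
   Both f(x', ys) and f(xs, y_k) are separated from f(xs, ys) by at least a
   squared gradient over twice the smoothness constant; through the L_xy-
   Lipschitz bounds this pays for the leftover squared gradients at (x', y')
   and (x', y_k), up to multiples of |y' - ys|^2 and |x' - xs|^2, which produce
   the denominators of the rate. *)
Require Import Defs.
From HB Require Import structures.
From mathcomp Require Import all_boot all_order all_algebra.
From mathcomp Require Import all_classical all_reals all_analysis.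
From mathcomp Require Import ring lra.

Set Implicit Arguments.
Unset Strict Implicit.
Unset Printing Implicit Defensive.

Import Order.TTheory GRing.Theory Num.Theory.
Import numFieldNormedType.Exports.

Local Open Scope ring_scope.

(** * The Euclidean inner product on row vectors *)

Section EuclideanProduct.
Context {R : realType}.
Variable n : nat.
Implicit Types u v w : 'rV[R]_n.

Lemma dotvC u v : dotv u v = dotv v u.
Proof. by apply: eq_bigr => i _; rewrite mulrC. Qed.

Lemma dotvDl u v w : dotv (u + v) w = dotv u w + dotv v w.
Proof. by rewrite -big_split; apply: eq_bigr => i _; rewrite mxE mulrDl. Qed.

Lemma dotvZl c u v : dotv (c *: u) v = c * dotv u v.
Proof. by rewrite mulr_sumr; apply: eq_bigr => i _; rewrite mxE mulrA. Qed.

Lemma dotvNl u v : dotv (- u) v = - dotv u v.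
Proof. by rewrite -scaleN1r dotvZl mulN1r. Qed.

Lemma dotvDr u v w : dotv u (v + w) = dotv u v + dotv u w.
Proof. by rewrite dotvC dotvDl !(dotvC u). Qed.

Lemma dotvZr c u v : dotv u (c *: v) = c * dotv u v.
Proof. by rewrite dotvC dotvZl dotvC. Qed.

Lemma dotvNr u v : dotv u (- v) = - dotv u v.
Proof. by rewrite dotvC dotvNl dotvC. Qed.

Definition dotvE := (dotvDl, dotvDr, dotvZl, dotvZr, dotvNl, dotvNr).

Lemma dotvv_ge0 u : 0 <= dotv u u.
Proof. by apply: sumr_ge0 => i _; rewrite -expr2 sqr_ge0. Qed.

Lemma dotvv_eq0 u : dotv u u = 0 -> u = 0.
Proof.
move=> u0; apply/rowP => i; apply/eqP; rewrite mxE -sqrf_eq0 expr2.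
by apply/eqP; apply: (psumr_eq0P _ u0) => // j _; rewrite -expr2 sqr_ge0.
Qed.

Lemma sqr_enorm u : enorm u ^+ 2 = dotv u u.
Proof. by rewrite sqr_sqrtr // dotvv_ge0. Qed.

Lemma dotv_young c u v : 2 * c * dotv u v <= dotv u u + c ^+ 2 * dotv v v.
Proof.
have := dotvv_ge0 (u - c *: v); rewrite !dotvE (dotvC v u); lra.
Qed.

Lemma dotvv_add_le u v : dotv (u + v) (u + v) <= 2 * dotv u u + 2 * dotv v v.
Proof.
have := dotv_young 1 u v; rewrite !dotvE (dotvC v u); lra.
Qed.

End EuclideanProduct.

Lemma enorm_le_dotv (R : realType) m n (c : R) (u : 'rV[R]_n) (v : 'rV[R]_m) :
  0 <= c -> enorm u <= c * enorm v -> dotv u u <= c ^+ 2 * dotv v v.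
Proof.
move=> c0 uv; rewrite -[dotv u u]sqr_enorm -[dotv v v]sqr_enorm -exprMn.
by apply: lerXn2r => //; rewrite nnegrE ?mulr_ge0 ?sqrtr_ge0.
Qed.

(** Lets the mesh of the subdivision in [descent] tend to zero. *)
Lemma le_of_le_add_div (R : archiRealFieldType) (a b c : R) :
  (forall N : nat, a <= b + c / N.+1%:R) -> a <= b.
Proof.
move=> h; rewrite leNgt; apply/negP => ba.
have ab : 0 < a - b by rewrite subr_gt0.
set N := Num.bound `|c / (a - b)|.
have cN : c / (a - b) < N%:R.
  by apply: le_lt_trans (ler_norm _) _; apply: archi_boundP.
have N0 : 0 < N.+1%:R :> R by rewrite ltr0n.
have := h N; rewrite -lerBlDl ler_pdivlMr // -natr1 => hN.
move: cN; rewrite ltr_pdivrMr // => cN; nra.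
Qed.

(** * Smooth convex functions *)

Section SmoothConvex.
Context {R : realType}.
Variables (n : nat) (g : 'rV[R]_n -> R) (G : 'rV[R]_n -> 'rV[R]_n) (L : R).
Hypothesis L_gt0 : 0 < L.
Hypothesis g_convex : forall z z', g z + dotv (G z) (z' - z) <= g z'.
Hypothesis G_lipschitz : forall z z',
  dotv (G z' - G z) (G z' - G z) <= L ^+ 2 * dotv (z' - z) (z' - z).

Lemma descent z d : g (z + d) <= g z + dotv (G z) d + L / 2 * dotv d d.
Proof.
(* Sum the convexity inequalities between consecutive points of a subdivision
   of the segment; the Riemann sum of [t * L] tends to [L / 2]. *)
have lip t : 0 < t -> dotv (G (z + t *: d)) d <= dotv (G z) d + L * t * dotv d d.
  move=> t0; have Lt0 : 0 < L * t by rewrite mulr_gt0.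
  have := G_lipschitz z (z + t *: d); rewrite addrAC subrr add0r.
  rewrite dotvZl dotvZr => lipz.
  (* Young's inequality balanced at [L * t] does the work of Cauchy-Schwarz. *)
  have := dotv_young (L * t) (G (z + t *: d) - G z) d.
  set D := dotv (_ - _) d => young.
  have -> : dotv (G (z + t *: d)) d = dotv (G z) d + D.
    by rewrite /D dotvDl dotvNl addrCA subrr addr0.
  rewrite lerD2l -(ler_pM2l Lt0); nra.
have sub h k : 0 < h -> g (z + (k%:R * h) *: d) <=
    g z + k%:R * h * dotv (G z) d + L * h ^+ 2 * (k%:R * (k%:R + 1) / 2) * dotv d d.
  move=> h0; elim: k => [|k IH]; first by rewrite !mul0r !mulr0 scale0r !mul0r !addr0.
  set z1 := z + (k.+1%:R * h) *: d.
  (* Convexity is used at the right endpoint [z1], hence the sum k (k + 1) / 2. *)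
  have := g_convex z1 (z + (k%:R * h) *: d).
  have -> : z + (k%:R * h) *: d - z1 = (- h) *: d.
    by rewrite /z1 opprD addrACA subrr add0r -scalerBl -mulrBl -natr1 opprD addNKr mulN1r.
  have := lip (k.+1%:R * h) (mulr_gt0 (ltr0Sn _ _) h0).
  rewrite -/z1 dotvZr -natr1 => {}lip conv.
  have : h * dotv (G z1) d <=
      h * (dotv (G z) d + L * ((k%:R + 1) * h) * dotv d d) by rewrite ler_pM2l.
  lra.
(* With mesh 1 / (N + 1) the coefficient of |d|^2 is L / 2 * (1 + 1 / (N + 1)). *)
apply: (@le_of_le_add_div _ _ _ (L / 2 * dotv d d)) => N.
have N0 : N.+1%:R != 0 :> R by rewrite pnatr_eq0.
have := sub N.+1%:R^-1 N.+1; rewrite invr_gt0 ltr0Sn => /(_ isT).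
rewrite mulfV // scale1r mul1r => /le_trans; apply.
by rewrite le_eqVlt; apply/orP; left; apply/eqP; field.
Qed.

Lemma gradient_step_decrease a z :
  g (z - a *: G z) <= g z - a * dotv (G z) (G z) + L / 2 * a ^+ 2 * dotv (G z) (G z).
Proof. by have := descent z (- (a *: G z)); rewrite !dotvE; lra. Qed.

(* Minimality of [zs] is tested against one gradient step of length [1 / L]. *)
Lemma dotv_gradient_le zs z :
  (forall w, g zs <= g w) -> dotv (G z) (G z) <= 2 * L * (g z - g zs).
Proof.
move=> min; have := le_trans (min _) (gradient_step_decrease L^-1 z).
have LV : L * L^-1 = 1 by rewrite mulfV // gt_eqF.
rewrite -(ler_pM2l (mulr_gt0 (ltr0Sn _ 1) L_gt0)); set D := dotv _ _.
have -> : 2 * L * (g z - L^-1 * D + L / 2 * L^-1 ^+ 2 * D) =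
  2 * L * g z - 2 * (L * L^-1) * D + (L * L^-1) ^+ 2 * D by field; rewrite gt_eqF.
rewrite LV; lra.
Qed.

Lemma gradient_eq0 zs : (forall w, g zs <= g w) -> G zs = 0.
Proof.
move=> min; apply: dotvv_eq0; apply/eqP; rewrite eq_le dotvv_ge0 andbT.
by have := dotv_gradient_le zs min; rewrite subrr mulr0.
Qed.

End SmoothConvex.

(** * Scalar inequalities behind decay and validity of Psi *)

Section RealInequalities.
Context {R : realType}.
Variables mx my Lx Ly Lxy a b : R.

(** The step size conditions with fractions cleared and roots squared away, so that L_xy = 0 is no
    special case. *)
Record small_steps : Prop := SmallSteps {
  mu_x_gt0 : 0 < mx;
  mu_y_gt0 : 0 < my;
  mu_x_le : mx <= Lx;
  mu_y_le : my <= Ly;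
  alpha_gt0 : 0 < a;
  beta_gt0 : 0 < b;
  alpha_L_x_le : 2 * (a * Lx) <= 1;
  beta_L_y_le : 2 * (b * Ly) <= 1;
  alpha_L_xy_le : 4 * (a ^+ 2 * Lx * Lxy ^+ 2) <= my;
  beta_L_xy_le : 4 * (b ^+ 2 * Ly * Lxy ^+ 2) <= mx
}.

Local Notation r := (rate_alt mx my Lx Ly Lxy a b).

Lemma small_steps_inv : small_steps ->
  [/\ 0 < Lx, 0 < Ly, 2 * Lx <= 1 / a & 2 * Ly <= 1 / b].
Proof.
by case=> mx0 my0 mxLx myLy a0 b0 aLx bLy _ _; split;
  rewrite ?ler_pdivlMr //; lra.
Qed.

(** The coupling conditions bound the subtracted terms by mx / 2 and my / 4, so each denominator
    exceeds its positive numerator. *)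
Lemma rate_alt_bounds : small_steps ->
  [/\ 0 < r < 1, 1 / a - mx <= r * (1 / a - 2 * b ^+ 2 * Ly * Lxy ^+ 2),
      1 / b - my <= r * (1 / b - a ^+ 2 * Lx * Lxy ^+ 2)
    & 1 / a - mx <= r * (1 / a)].
Proof.
move=> steps; have [Lx0 Ly0 aV bV] := small_steps_inv steps.
case: steps => mx0 my0 mxLx myLy _ _ _ _ aLxy bLxy.
have num : 0 < 1 / a - mx by lra.
have den1 : 0 < 1 / a - 2 * b ^+ 2 * Ly * Lxy ^+ 2 by lra.
have den2 : 0 < 1 / b - a ^+ 2 * Lx * Lxy ^+ 2 by lra.
have den3 : 0 < 1 / a by lra.
split.
- rewrite lt_max (divr_gt0 num den3) orbT /= !gt_max !ltr_pdivrMr //.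
  by apply/andP; split; [apply/andP; split|]; lra.
- by rewrite -ler_pdivrMr // !le_max lexx.
- by rewrite -ler_pdivrMr // !le_max lexx orbT.
- by rewrite -ler_pdivrMr // !le_max lexx !orbT.
Qed.

(* [Xi] and [Yi] stand for the squared distances of x_{k+i} and y_{k+i} to the
   equilibrium (xs, ys), and [fij] for f(x_{k+i}, y_{k+j}), an index [s] denoting
   xs or ys. [A0], [A1] and [P] are the squared norms of grad_x f at (x_k, y_k),
   (x_{k+1}, y_{k+1}) and (x_{k+1}, ys), while [G] and [Q] are those of grad_y f
   at (x_{k+1}, y_k) and (xs, y_k). *)
Lemma Psi_alt_contraction (X0 X1 X2 Y0 Y1 A0 A1 G P Q f00 f10 f11 f1s fs0 fs1 fss : R) :
  small_steps -> 0 <= X1 -> 0 <= X2 -> 0 <= Y1 -> 0 <= A1 -> 0 <= G -> 0 <= P -> 0 <= Q ->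
  1 / a * X1 <= (1 / a - mx) * X0 + 2 * (fs0 - f00) + a * A0 ->
  1 / a * X2 <= (1 / a - mx) * X1 + 2 * (fs1 - f11) + a * A1 ->
  1 / b * Y1 <= (1 / b - my) * Y0 + 2 * (f10 - f1s) + b * G ->
  f10 <= f00 - a * A0 + Lx / 2 * a ^+ 2 * A0 ->
  f10 + b * G - Ly / 2 * b ^+ 2 * G <= f11 ->
  P <= 2 * Lx * (f1s - fss) -> Q <= 2 * Ly * (fss - fs0) -> fs1 <= fss ->
  A1 <= 2 * Lxy ^+ 2 * Y1 + 2 * P -> G <= 2 * Lxy ^+ 2 * X1 + 2 * Q ->
  (1 / a - mx) * X1 + (1 / b - my) * Y1 + ((1 / a - mx) * X2 + (1 / b - my) * Y1)
    - a * (1 - a * Lx) * A1 <=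
  r * ((1 / a - mx) * X0 + (1 / b - my) * Y0 + ((1 / a - mx) * X1 + (1 / b - my) * Y0)
    - a * (1 - a * Lx) * A0).
Proof.
move=> steps X1_ge0 X2_ge0 Y1_ge0 A1_ge0 G_ge0 P_ge0 Q_ge0 hx0 hx1 hy dx dy hP hQ hs hA1 hG.
have [/andP[r0 r1] rX1 rY1 rX2] := rate_alt_bounds steps.
have [Lx0 Ly0 aV bV] := small_steps_inv steps.
case: steps => mx0 my0 mxLx myLy a0 b0 aLx bLy aLxy bLxy.
set Psi0 := (X in _ <= _ * X).
have f1s_ge : 0 <= f1s - fss by rewrite -(pmulr_rge0 _ (_ : 0 < 2 * Lx)); lra.
(* [2 * (a * Lx) <= 1] absorbs the smoothness constant of [hP]; likewise for [bQ]. *)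
have aP : a ^+ 2 * Lx * P <= f1s - fss.
  have : a ^+ 2 * Lx * P <= a ^+ 2 * Lx * (2 * Lx * (f1s - fss)).
    by rewrite ler_wpM2l // mulr_ge0 ?sqr_ge0 // ltW.
  have : (2 * (a * Lx)) ^+ 2 * (f1s - fss) <= 1 * (f1s - fss).
    by rewrite ler_wpM2r // expr_le1 // ?mulr_ge0 // ltW.
  lra.
have fs0_le : 0 <= fss - fs0 by rewrite -(pmulr_rge0 _ (_ : 0 < 2 * Ly)); lra.
have bQ : b ^+ 2 * Ly * Q <= (fss - fs0) / 2.
  have : b ^+ 2 * Ly * Q <= b ^+ 2 * Ly * (2 * Ly * (fss - fs0)).
    by rewrite ler_wpM2l // mulr_ge0 ?sqr_ge0 // ltW.
  have : (2 * (b * Ly)) ^+ 2 * (fss - fs0) <= 1 * (fss - fs0).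
    by rewrite ler_wpM2r // expr_le1 // ?mulr_ge0 // ltW.
  lra.
have bG : b ^+ 2 * Ly * G <= b ^+ 2 * Ly * (2 * Lxy ^+ 2 * X1 + 2 * Q).
  by rewrite ler_wpM2l // mulr_ge0 ?sqr_ge0 // ltW.
have aA1 : a ^+ 2 * Lx * A1 <= a ^+ 2 * Lx * (2 * Lxy ^+ 2 * Y1 + 2 * P).
  by rewrite ler_wpM2l // mulr_ge0 ?sqr_ge0 // ltW.
(* Sum of [hx0], [hx1] and twice [hy], [dx], [dy]. After [aA1] and [bG] the values of f left over
   total at most -2 (f1s - fss) - (fss - fs0) - 2 (fss - fs1) <= 0. *)
have Psi0_ge : (1 / a - 2 * b ^+ 2 * Ly * Lxy ^+ 2) * X1 + 1 / a * X2
    + 2 * (1 / b - a ^+ 2 * Lx * Lxy ^+ 2) * Y1 - a * (1 - a * Lx) * A1 <= Psi0.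
  rewrite /Psi0; lra.
have := ler_wpM2l (ltW r0) Psi0_ge.
have := ler_wpM2r X1_ge0 rX1.
have := ler_wpM2r X2_ge0 rX2.
have := ler_wpM2r Y1_ge0 rY1.
(* This term is subtracted in Psi, so it calls for r <= 1. *)
have : r * (a * (1 - a * Lx) * A1) <= a * (1 - a * Lx) * A1.
  by rewrite ler_piMl ?(ltW r1) // !mulr_ge0 ?(ltW a0) //; lra.
lra.
Qed.

(* Here [P] is the squared norm of grad_x f at (x_k, ys). *)
Lemma Psi_alt_lower_bound (X0 X1 Y0 A0 P : R) :
  small_steps -> 0 <= X0 -> 0 <= X1 -> 0 <= Y0 -> 0 <= A0 -> P <= Lx ^+ 2 * X0 ->
  A0 <= 2 * Lxy ^+ 2 * Y0 + 2 * P ->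
  Num.min (1 / (4 * a)) (1 / (2 * b)) * (X0 + Y0) <=
  (1 / a - mx) * X0 + (1 / b - my) * Y0 + ((1 / a - mx) * X1 + (1 / b - my) * Y0)
    - a * (1 - a * Lx) * A0.
Proof.
move=> steps X0_ge0 X1_ge0 Y0_ge0 A0_ge0 hP hA0.
have [Lx0 Ly0 aV bV] := small_steps_inv steps.
case: steps => mx0 my0 mxLx myLy a0 b0 aLx bLy aLxy bLxy.
have ab : 4 * (a * b * Lxy ^+ 2) <= 1.
  (* Multiply the two coupling conditions: (4 a b Lxy^2)^2 Lx Ly <= mx my <= Lx Ly *)
  have ab_ge0 : 0 <= 4 * (a * b * Lxy ^+ 2).
    by rewrite pmulr_rge0 // mulr_ge0 ?sqr_ge0 // mulr_ge0 // ltW.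
  rewrite -(@expr_le1 _ 2) //.
  have LL : 0 < Lx * Ly by rewrite mulr_gt0.
  rewrite -(ler_pM2r LL) mul1r.
  have prod_ge0 (t L : R) : 0 < L -> 0 <= 4 * (t ^+ 2 * L * Lxy ^+ 2).
    by move=> L0; rewrite pmulr_rge0 // mulr_ge0 ?sqr_ge0 // mulr_ge0 ?sqr_ge0 // ltW.
  have := ler_pM (prod_ge0 a _ Lx0) (prod_ge0 b _ Ly0) aLxy bLxy.
  have := ler_pM (ltW mx0) (ltW my0) mxLx myLy.
  lra.
have aLxy_le : a * Lxy ^+ 2 <= 1 / b / 4.
  by rewrite ler_pdivlMr // ler_pdivlMr //; lra.
have aX : a * (2 * P) <= 1 / a / 2 * X0.
  have -> : 1 / a / 2 * X0 = a * (2 * (1 / (4 * a ^+ 2) * X0)).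
    by field; rewrite gt_eqF.
  rewrite ler_pM2l // ler_pM2l //; apply: le_trans hP _; apply: ler_wpM2r => //.
  rewrite ler_pdivlMr ?mulr_gt0 ?exprn_gt0 //.
  have -> : Lx ^+ 2 * (4 * a ^+ 2) = (2 * (a * Lx)) ^+ 2 by ring.
  by rewrite expr_le1 // !mulr_ge0 ?ltW.
(* Source of the two constants: the gradient term costs at most (1 - a Lx) (X0 / (2 a) + Y0 / (2
   b)). With mx <= Lx <= 1 / (2 a) and my <= Ly <= 1 / (2 b) this leaves X0 / (4 a) and Y0 / (2
   b). *)
have m1 : Num.min (1 / (4 * a)) (1 / (2 * b)) <= 1 / a / 4.
  by rewrite ge_min; apply/orP; left; rewrite -mulrA -invfM [a * _]mulrC.
have m2 : Num.min (1 / (4 * a)) (1 / (2 * b)) <= 1 / b / 2.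
  by rewrite ge_min; apply/orP; right; rewrite -mulrA -invfM [b * _]mulrC.
have := ler_wpM2r X0_ge0 m1; have := ler_wpM2r Y0_ge0 m2.
have aA : a * (1 - a * Lx) * A0 <= (1 - a * Lx) * (a * (2 * Lxy ^+ 2 * Y0 + 2 * P)).
  rewrite -[X in X <= _]mulrA mulrCA; apply: ler_wpM2l; first by lra.
  by rewrite ler_pM2l.
have aA' : (1 - a * Lx) * (a * (2 * Lxy ^+ 2 * Y0 + 2 * P)) <=
    (1 - a * Lx) * (1 / b / 2 * Y0 + 1 / a / 2 * X0).
  by rewrite ler_wpM2l //; [lra | have := ler_wpM2r Y0_ge0 aLxy_le; lra].
have Xcoef : 0 <= (1 / a - 2 * Lx) * X0 by rewrite mulr_ge0 //; lra.
have Xcoef' : 0 <= (Lx - mx) * X0 by rewrite mulr_ge0 //; lra.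
have X1coef : 0 <= (1 / a - mx) * X1 by rewrite mulr_ge0 //; lra.
have Ycoef : 0 <= (1 / b - 2 * Ly) * Y0 by rewrite mulr_ge0 //; lra.
have Ycoef' : 0 <= (Ly - my) * Y0 by rewrite mulr_ge0 //; lra.
have aLxb : 0 <= a * Lx * (1 / b * Y0)
  by rewrite !mulr_ge0 ?invr_ge0 ?(ltW a0) ?(ltW b0) ?(ltW Lx0).
have aE : a * Lx * (1 / a / 2 * X0) = Lx / 2 * X0 by field; rewrite gt_eqF.
lra.
Qed.

End RealInequalities.

Lemma step_size_condP (R : realType) (mu L Lxy a : R) :
  0 < mu -> 0 < L -> 0 <= Lxy -> 0 < a -> step_size_cond mu L Lxy a ->
  2 * (a * L) <= 1 /\ 4 * (a ^+ 2 * L * Lxy ^+ 2) <= mu.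
Proof.
move=> mu0 L0 Lxy0 a0; rewrite /step_size_cond => h.
have half0 : (0 <= (1 / 2)%:E :> \bar R)%E by rewrite lee_fin; lra.
split.
  have : (a%:E <= (1 / 2)%:E * (1%:E / L%:E))%E.
    by apply: (le_trans h); rewrite lee_wpmul2l // ge_min lexx.
  by rewrite inver gt_eqF // -!EFinM lee_fin mulrA ler_pdivlMr //; lra.
(* For L_xy = 0 the claim is just 0 <= mu; otherwise the second bound is squared. *)
case: (ltgtP 0 Lxy) Lxy0 => // [Lxy0|<-] _; last by rewrite expr0n !mulr0 ltW.
have s0 : 0 < Lxy * Num.sqrt L by rewrite mulr_gt0 // sqrtr_gt0.
have : (a%:E <= (1 / 2)%:E * ((Num.sqrt mu)%:E / (Lxy * Num.sqrt L)%:E))%E.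
  by apply: (le_trans h); rewrite lee_wpmul2l // ge_min lexx orbT.
rewrite inver gt_eqF // -!EFinM lee_fin mulrA ler_pdivlMr // => {}h.
have : 2 * (a * (Lxy * Num.sqrt L)) <= Num.sqrt mu by lra.
rewrite -(@ler_pXn2r _ 2) // ?nnegrE ?sqrtr_ge0 ?mulr_ge0 ?(ltW a0) ?(ltW Lxy0) ?sqrtr_ge0 //.
have -> : (2 * (a * (Lxy * Num.sqrt L))) ^+ 2 =
  4 * (a ^+ 2 * Num.sqrt L ^+ 2 * Lxy ^+ 2) by ring.
by rewrite !sqr_sqrtr ?(ltW mu0) ?(ltW L0).
Qed.

(** * Partial gradients and the function class *)

Lemma gradN (R : realType) n (g : 'rV[R]_n -> R) z :
  (forall v, derivable g z v) -> grad (fun w => - g w) z = - grad g z.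
Proof. by move=> dg; apply/rowP => i; rewrite !mxE deriveN. Qed.

(** The difference quotient of the slice along v is that of f along (0, v). *)
Lemma derivable_snd (R : realType) m n (f : 'rV[R]_m * 'rV[R]_n -> R) x y v :
  differentiable f (x, y) -> derivable (fun w => f (x, w)) y v.
Proof.
move=> /(@diff_derivable _ _ _ f (x, y) (0, v)); rewrite /derivable.
move=> d; have <- : (fun h : R => h^-1 *: ((f \o shift (x, y)) (h *: (0, v)) - f (x, y))) =
    (fun h => h^-1 *: (((fun w => f (x, w)) \o shift y) (h *: v) - f (x, y))).
  apply/funext => h; rewrite /= /shift.
  suff -> : h *: ((0, v) : 'rV[R]_m * 'rV[R]_n) + (x, y) = (x, h *: v + y) by [].
  by rewrite -[RHS]/(x, _) -[x in RHS]add0r -[X in (X + x, _)](scaler0 _ h).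
exact: d.
Qed.

(** Expand |e - a Gz|^2 with e = z - zs; strong convexity bounds the cross term. *)
Lemma gradient_step_dist (R : realType) n (mu a gz gzs : R)
    (Gz z zs : 'rV[R]_n) :
  0 < a -> gz + dotv Gz (zs - z) + mu / 2 * dotv (zs - z) (zs - z) <= gzs ->
  1 / a * dotv (z - a *: Gz - zs) (z - a *: Gz - zs) <=
  (1 / a - mu) * dotv (z - zs) (z - zs) + 2 * (gzs - gz) + a * dotv Gz Gz.
Proof.
move=> a0; rewrite (addrAC z) -(opprB z zs); move: (z - zs) => e.
rewrite !dotvE (dotvC Gz e); set D := dotv e Gz.
have -> : 1 / a * (dotv e e + - (a * D) + (- (a * D) + - (a * - (a * dotv Gz Gz)))) =
  1 / a * dotv e e - 2 * D + a * dotv Gz Gz by field; rewrite gt_eqF.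
lra.
Qed.

Section FunctionClass.
Context {R : realType}.
Variables (mx my Lx Ly Lxy : R) (dx dy : nat) (f : 'rV[R]_dx * 'rV[R]_dy -> R).
Hypothesis hf : function_class mx my Lx Ly Lxy f.

Lemma class_convex_x_dotv y z z' :
  f (z, y) + dotv (gradx f z y) (z' - z) + mx / 2 * dotv (z' - z) (z' - z) <= f (z', y).
Proof. by rewrite -[dotv (z' - z) _]sqr_enorm; apply: class_convex_x hf y z z'. Qed.

Lemma class_concave_y_dotv x z z' :
  - f (x, z) + dotv (- grady f x z) (z' - z) + my / 2 * dotv (z' - z) (z' - z) <=
  - f (x, z').
Proof.
rewrite -[dotv (z' - z) _]sqr_enorm /grady -gradN; first exact: class_concave_y hf x z z'.
by move=> v; apply: derivable_snd; apply: (class_twice_diff hf).1.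
Qed.

Lemma class_convex_x0 y z z' : 0 < mx ->
  f (z, y) + dotv (gradx f z y) (z' - z) <= f (z', y).
Proof.
move=> mx0; have := class_convex_x_dotv y z z'.
have := mulr_ge0 (ltW mx0) (dotvv_ge0 (z' - z)); lra.
Qed.

Lemma class_concave_y0 x z z' : 0 < my ->
  - f (x, z) + dotv (- grady f x z) (z' - z) <= - f (x, z').
Proof.
move=> my0; have := class_concave_y_dotv x z z'.
have := mulr_ge0 (ltW my0) (dotvv_ge0 (z' - z)); lra.
Qed.

Lemma class_lip_yy_dotv x z z' : 0 < Ly ->
  dotv (- grady f x z' - - grady f x z) (- grady f x z' - - grady f x z) <=
  Ly ^+ 2 * dotv (z' - z) (z' - z).
Proof.
move=> Ly0; rewrite -opprD dotvNl dotvNr opprK.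
by apply: enorm_le_dotv (class_lip_yy hf x z z'); rewrite ltW.
Qed.

Lemma gradx_le_add x y y' : 0 <= Lxy ->
  dotv (gradx f x y) (gradx f x y) <=
  2 * Lxy ^+ 2 * dotv (y - y') (y - y') + 2 * dotv (gradx f x y') (gradx f x y').
Proof.
move=> Lxy0; have := dotvv_add_le (gradx f x y - gradx f x y') (gradx f x y').
have := enorm_le_dotv Lxy0 (class_lip_xy hf x y' y); rewrite subrK; lra.
Qed.

Lemma grady_le_add x x' y : 0 <= Lxy ->
  dotv (grady f x y) (grady f x y) <=
  2 * Lxy ^+ 2 * dotv (x - x') (x - x') + 2 * dotv (- grady f x' y) (- grady f x' y).
Proof.
move=> Lxy0; have := dotvv_add_le (grady f x y - grady f x' y) (grady f x' y).
rewrite dotvNl dotvNr opprK.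
have := enorm_le_dotv Lxy0 (class_lip_yx hf x' x y); rewrite subrK; lra.
Qed.

End FunctionClass.

Theorem theorem4p1 (R : realType) (mu_x mu_y L_x L_y L_xy : R)
    (hmux : 0 < mu_x) (hLx : mu_x <= L_x)
    (hmuy : 0 < mu_y) (hLy : mu_y <= L_y) (hLxy : 0 <= L_xy)
    (dx dy : nat) (f : 'rV[R]_dx * 'rV[R]_dy -> R)
    (hf : function_class mu_x mu_y L_x L_y L_xy f)
    (zs : 'rV[R]_dx * 'rV[R]_dy) (hzs : nash_equilibrium f zs)
    (alpha beta : R) (halpha : 0 < alpha) (hbeta : 0 < beta)
    (halpha_le : step_size_cond mu_y L_x L_xy alpha)
    (hbeta_le : step_size_cond mu_x L_y L_xy beta)
    (x : nat -> 'rV[R]_dx) (y : nat -> 'rV[R]_dy)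
    (hrun : alt_gda f alpha beta x y) :
  let Psi := Psi_alt f mu_x mu_y L_x alpha beta zs x y in
  let r := rate_alt mu_x mu_y L_x L_y L_xy alpha beta in
  (exists2 A : R, 0 < A &
     forall k, A * enorm_pair ((x k, y k) - zs) ^+ 2 <= Psi k) /\
  (forall k, Psi k.+1 <= r * Psi k) /\
  0 < r < 1.
Proof.
case: zs hzs => xs ys hzs.
have Lx0 : 0 < L_x := lt_le_trans hmux hLx.
have Ly0 : 0 < L_y := lt_le_trans hmuy hLy.
have [aLx aLxy] := step_size_condP hmuy Lx0 hLxy halpha halpha_le.
have [bLy bLxy] := step_size_condP hmux Ly0 hLxy hbeta hbeta_le.
have steps : small_steps mu_x mu_y L_x L_y L_xy alpha beta by [].
have min_x u : f (xs, ys) <= f (u, ys) by have [] := hzs u ys.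
have max_y v : - f (xs, ys) <= - f (xs, v) by rewrite lerN2; have [] := hzs xs v.
have cvx v z z' := class_convex_x0 hf v z z' hmux.
(* The y block is treated as convex: -f(u, .) with gradient [- grady f u]. *)
have ccv u z z' := class_concave_y0 hf u z z' hmuy.
have lipx v z z' := enorm_le_dotv (ltW Lx0) (class_lip_xx hf z z' v).
have lipy u z z' := class_lip_yy_dotv hf u z z' Ly0.
have PsiE k : Psi_alt f mu_x mu_y L_x alpha beta (xs, ys) x y k =
    (1 / alpha - mu_x) * dotv (x k - xs) (x k - xs)
    + (1 / beta - mu_y) * dotv (y k - ys) (y k - ys)
    + ((1 / alpha - mu_x) * dotv (x k.+1 - xs) (x k.+1 - xs)
       + (1 / beta - mu_y) * dotv (y k - ys) (y k - ys))
    - alpha * (1 - alpha * L_x) * dotv (gradx f (x k) (y k)) (gradx f (x k) (y k)).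
  by rewrite /Psi_alt /V_alt !sqr_enorm.
have [r01 _ _ _] := rate_alt_bounds steps.
split; last split=> //.
- exists (Num.min (1 / (4 * alpha)) (1 / (2 * beta))).
    by rewrite lt_min !divr_gt0 // mulr_gt0.
  move=> k; rewrite PsiE sqr_sqrtr ?addr_ge0 ?sqr_ge0 // !sqr_enorm /=.
  apply: (Psi_alt_lower_bound (P := dotv (gradx f (x k) ys) (gradx f (x k) ys)) steps);
    rewrite ?dotvv_ge0 ?(gradx_le_add hf) //.
  (* grad_x f vanishes at the equilibrium, so this bounds P by Lx^2 X0. *)
  have := lipx ys xs (x k).
  by rewrite (gradient_eq0 Lx0 (cvx ys) (lipx ys) min_x) subr0.
- move=> k; rewrite !PsiE.
  have [x1 y1] := hrun k; have [x2 _] := hrun k.+1.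
  have hx0 := gradient_step_dist halpha (class_convex_x_dotv hf (y k) (x k) xs).
  have hx1 := gradient_step_dist halpha (class_convex_x_dotv hf (y k.+1) (x k.+1) xs).
  have hy := gradient_step_dist hbeta (class_concave_y_dotv hf (x k.+1) (y k) ys).
  have dx0 := gradient_step_decrease Lx0 (cvx (y k)) (lipx (y k)) alpha (x k).
  have dy0 := gradient_step_decrease Ly0 (ccv (x k.+1)) (lipy (x k.+1)) beta (y k).
  have hP := dotv_gradient_le Lx0 (cvx ys) (lipx ys) (x k.+1) min_x.
  have hQ := dotv_gradient_le Ly0 (ccv xs) (lipy xs) (y k) max_y.
  have hA := gradx_le_add hf (x k.+1) (y k.+1) ys hLxy.
  have hG := grady_le_add hf (x k.+1) xs (y k) hLxy.
  rewrite -x1 in hx0 dx0; rewrite -x2 in hx1.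
  rewrite scalerN opprK -y1 dotvNl dotvNr opprK in hy dy0.
  apply: (Psi_alt_contraction steps _ _ _ _ _ _ _ hx0 hx1 _ dx0 _ hP _ _ hA hG);
    rewrite ?dotvv_ge0 //; [move: hy | move: dy0 | move: hQ | move: (max_y (y k.+1))]; lra.
Qed.
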